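(* The base curve $\alpha$ is a line of curvature on the GNR-surface $F_{(\alpha,q_n)}$ if and only if the system $$\begin{cases} a_2'+a_1\tau=0\\ a_1'-a_2\tau=0\end{cases}$$ is satisfied (on $I$).
   Context: Let $I\subset\mathbb{R}$ be an open interval and $\alpha:I\to\mathbb{R}^3$ a smooth unit speed curve with arclength parameter $s$, positively oriented orthonormal Frenet frame $\{\vec T,\vec N,\vec B\}$, curvature $\kappa$ and torsion $\tau$: $\vec T=\vec\alpha'$, $\vec T'=\kappa\vec N$, $\vec N'=-\kappa\vec T+\tau\vec B$, $\vec B'=-\tau\vec N$ (prime is $d/ds$). Convention: either $\kappa>0$ on $I$, or $\alpha$ is a straight line, in which case $\kappa=\tau=0$ and $\vec N,\vec B$ are chosen constant. Let $a_1,a_2:I\to\mathbb{R}$ be smooth with $a_1^2+a_2^2=1$. The generalized normal ruled surface (GNR-surface) of $\alpha$ is $\vec F_{(\alpha,q_n)}(s,u)=\vec\alpha(s)+u\,\vec q_n(s)$, $(s,u)\in I\times\mathbb{R}$, with $\vec q_n=a_1\vec N+a_2\vec B$. The unit surface normal along $\alpha$ (i.e. at $u=0$) is $\vec U_\alpha=-a_2\vec N+a_1\vec B$. The curve $\alpha$ is a line of curvature if $\vec\alpha'\times\vec U_\alpha'=0$ on $I$. *)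

(* Defs.v *)
From HB Require Import structures.
From mathcomp Require Import all_boot all_order all_algebra.
From mathcomp Require Import all_classical all_reals all_analysis.

Set Implicit Arguments.
Unset Strict Implicit.
Unset Printing Implicit Defensive.

Import Order.TTheory GRing.Theory Num.Theory.
Import numFieldNormedType.Exports.

Local Open Scope classical_set_scope.
Local Open Scope ring_scope.

(* Coordinate indices live in 'I_3, so k + 1 and k + 2 are taken modulo 3. *)
Definition crossmul (R : realType) (v w : 'rV[R]_3) : 'rV[R]_3 :=
  \row_(k < 3) (v 0 (k + 1) * w 0 (k + 2%:R) - v 0 (k + 2%:R) * w 0 (k + 1)).

(* The norm `|v| of the library on 'rV[R]_3 is the sup norm. *)
Definition enorm (R : realType) (v : 'rV[R]_3) : R :=
  Num.sqrt (\sum_(k < 3) v 0 k ^+ 2).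

(* Curves are total functions on R of which only the restriction to an open
   set I matters: on such an I the iterated derivatives depend only on f|I. *)
Definition smooth_on (R : realType) (V : normedModType R) (I : set R)
    (f : R -> V) : Prop :=
  forall (n : nat) (s : R), I s -> derivable (derive1n n f) s 1.

Definition unit_speed_on (R : realType) (I : set R)
    (alpha : R -> 'rV[R]_3) : Prop :=
  forall s, I s -> enorm (derive1 alpha s) = 1.

Definition frame_mx (R : realType) (t n b : 'rV[R]_3) : 'M[R]_3 :=
  \matrix_(i < 3) [:: t; n; b]`_i.

Definition pos_orthonormal (R : realType) (t n b : 'rV[R]_3) : Prop :=
  frame_mx t n b *m (frame_mx t n b)^T = 1%:M /\ 0 < \det (frame_mx t n b).

(* [is_derive s 1 f l] states both that f is differentiable at s and that
   f'(s) = l. *)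
Record frenet_on (R : realType) (I : set R) (alpha T N B : R -> 'rV[R]_3)
    (kappa tau : R -> R) : Prop := FrenetOn {
  frenet_frame : forall s, I s -> pos_orthonormal (T s) (N s) (B s);
  frenet_alpha : forall s : R, I s -> is_derive s 1 alpha (T s);
  frenet_T : forall s : R, I s -> is_derive s 1 T (kappa s *: N s);
  frenet_N : forall s : R, I s ->
    is_derive s 1 N (- kappa s *: T s + tau s *: B s);
  frenet_B : forall s : R, I s -> is_derive s 1 B (- tau s *: N s);
  frenet_convention :
    (forall s, I s -> 0 < kappa s) \/
    [/\ exists p v : 'rV[R]_3, forall s, I s -> alpha s = p + s *: v,
        forall s, I s -> kappa s = 0 /\ tau s = 0 &
        exists n b : 'rV[R]_3, forall s, I s -> N s = n /\ B s = b]
}.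

Definition normal_field (R : realType) (a1 a2 : R -> R)
    (N B : R -> 'rV[R]_3) (s : R) : 'rV[R]_3 :=
  a1 s *: N s + a2 s *: B s.

Definition ruled_surface (R : realType) (alpha q : R -> 'rV[R]_3)
    (s u : R) : 'rV[R]_3 :=
  alpha s + u *: q s.

Definition gnr_surface (R : realType) (alpha N B : R -> 'rV[R]_3)
    (a1 a2 : R -> R) : R -> R -> 'rV[R]_3 :=
  ruled_surface alpha (normal_field a1 a2 N B).

(* (F_s x F_u) / |F_s x F_u|.  For the GNR-surface at u = 0 one has F_s = T
   and F_u = a1 N + a2 B, so this is U_alpha = - a2 N + a1 B. *)
Definition unit_surface_normal (R : realType) (F : R -> R -> 'rV[R]_3)
    (s u : R) : 'rV[R]_3 :=
  let n := crossmul (derive1 (F^~ u) s) (derive1 (F s) u) in (enorm n)^-1 *: n.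

Definition base_curve_line_of_curvature (R : realType) (I : set R)
    (alpha : R -> 'rV[R]_3) (F : R -> R -> 'rV[R]_3) : Prop :=
  let U := fun s => unit_surface_normal F s 0 in
  forall s, I s -> crossmul (derive1 alpha s) (derive1 U s) = 0.

(* Main.v *)
Require Import Defs.
From HB Require Import structures.
From mathcomp Require Import all_boot all_order all_algebra.
From mathcomp Require Import all_classical all_reals all_analysis.
From mathcomp Require Import ring.
Import Order.TTheory GRing.Theory Num.Theory.
Import numFieldNormedType.Exports.
Local Open Scope classical_set_scope.
Local Open Scope ring_scope.

(** At u = 0 the surface has partial derivatives F_s = T and
    F_u = q = a1 N + a2 B.  In a positively oriented orthonormal frame
    T x N = B and T x B = - N, so F_s x F_u = - a2 N + a1 B, which already has
    length 1 because a1^2 + a2^2 = 1; this is U.  The Frenet equations and the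
    product rule give
      U' = kappa a2 T - (a2' + a1 tau) N + (a1' - a2 tau) B.
    Crossing with alpha' = T kills the T-component and turns the other two by a
    quarter of a circle:
      alpha' x U' = - (a1' - a2 tau) N - (a2' + a1 tau) B
    ([gnr_crossmul_tangent]).  Since N and B are linearly independent
    ([frame_nb_eq0]), this vanishes at a parameter s exactly when both equations
    of the system hold at s.

    The cross products of the frame vectors come from one fact about the matrix
    M with rows T, N, B: it is a rotation, so it equals its own cofactor matrix
    ([frame_cofactor]), and the cofactors of a 3 x 3 matrix along a row are the
    coordinates of the cross product of the other two rows. *)

(** * The cross product and the Euclidean norm *)

Lemma crossmulDr (R : realType) (u v w : 'rV[R]_3) :
  crossmul u (v + w) = crossmul u v + crossmul u w.
Proof. by apply/rowP => k; rewrite !mxE; ring. Qed.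

Lemma crossmulZr (R : realType) (c : R) (u v : 'rV[R]_3) :
  crossmul u (c *: v) = c *: crossmul u v.
Proof. by apply/rowP => k; rewrite !mxE; ring. Qed.

Lemma crossmulvv (R : realType) (u : 'rV[R]_3) : crossmul u u = 0.
Proof. by apply/rowP => k; rewrite !mxE; ring. Qed.

Lemma enormE (R : realType) (v : 'rV[R]_3) :
  enorm v = Num.sqrt ((v *m v^T) 0 0).
Proof.
by rewrite /enorm mxE; congr Num.sqrt; apply: eq_bigr => k _; rewrite mxE.
Qed.

(** * Positively oriented orthonormal frames *)

Lemma det_mx22 (R : comNzRingType) (A : 'M[R]_2) :
  \det A = A 0 0 * A 1 1 - A 0 1 * A 1 0.
Proof.
rewrite (expand_det_row _ 0) !big_ord_recl big_ord0 /cofactor !det_mx11 !mxE.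
have lift00 : lift 0 0 = 1 :> 'I_2 by apply/val_inj.
have lift10 : lift 1 0 = 0 :> 'I_2 by apply/val_inj.
by rewrite !lift00 !lift10 /= expr0 expr1 mul1r mulN1r mulrN addr0.
Qed.

(** Taking the two remaining rows and columns in cyclic order absorbs the sign
    (-1)^(i+j): leaving out the middle index swaps the order of the other two,
    which is exactly when that sign contributes -1. *)
Lemma cofactor_cyclic (R : comNzRingType) (A : 'M[R]_3) (i j : 'I_3) :
  cofactor A i j = A (i + 1) (j + 1) * A (i + 2%:R) (j + 2%:R)
                   - A (i + 1) (j + 2%:R) * A (i + 2%:R) (j + 1).
Proof.
(* Entries are read through natural-number indices, so that in each of the nine
   cases the indices compute and the two sides mention the same atoms. *)
have [f Af] : exists f : nat -> nat -> R, forall k l, A k l = f k l.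
  by exists (fun k l => A (inord k) (inord l)) => k l; rewrite !inord_val.
rewrite /cofactor det_mx22 !mxE !Af.
by case: i j => [[|[|[|//]]] ?] [[|[|[|//]]] ?];
  rewrite /bump /= ?exprS ?expr0; ring.
Qed.

Section Frame.
Context {R : realType} {t n b : 'rV[R]_3}.
Hypothesis frame : pos_orthonormal t n b.

(** Orthonormality gives M^-1 = M^T and det M = 1 or -1, orientation excludes
    -1, and then adj M = (det M) M^-1 = M^T. *)
Lemma frame_cofactor (i j : 'I_3) :
  cofactor (frame_mx t n b) i j = frame_mx t n b i j.
Proof.
have [orth det_gt0] := frame; set M := frame_mx t n b in orth det_gt0 *.
have detM : \det M = 1.
  have := congr1 determinant orth.
  rewrite det_mulmx det_tr det1 -expr2 => /eqP; rewrite sqrf_eq1.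
  case/orP => /eqP // detN; move: det_gt0.
  by rewrite detN ltrNr oppr0 ltr10.
have adjM : \adj M = M^T.
  rewrite -[LHS]mul1mx -(mulmx1C orth) -mulmxA mul_mx_adj detM.
  by rewrite mulmx1.
by have := congr1 (fun A : 'M[R]_3 => A j i) adjM; rewrite !mxE.
Qed.

(** Contains T x N = B (i = 2), N x B = T (i = 0) and B x T = N (i = 1). *)
Lemma frame_crossmul (i : 'I_3) :
  crossmul (row (i + 1) (frame_mx t n b)) (row (i + 2%:R) (frame_mx t n b)) =
  row i (frame_mx t n b).
Proof.
by apply/rowP => k; rewrite [RHS]mxE -frame_cofactor cofactor_cyclic !mxE.
Qed.

Lemma crossmul_frame_tn : crossmul t n = b.
Proof. by have := frame_crossmul 2%:R; rewrite !rowK. Qed.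

Lemma crossmul_frame_tb : crossmul t b = - n.
Proof.
have := frame_crossmul 1; rewrite !rowK /= => <-.
by apply/rowP => k; rewrite !mxE; ring.
Qed.

Lemma frame_dot (i j : 'I_3) :
  [:: t; n; b]`_i *m ([:: t; n; b]`_j)^T = (i == j)%:R%:M.
Proof.
have [orth _] := frame.
apply/rowP => k; rewrite !ord1.
have := congr1 (fun A : 'M[R]_3 => A i j) orth; rewrite !mxE mulr1n => <-.
by apply: eq_bigr => l _; rewrite !mxE.
Qed.

Lemma frame_dot_nb (p q : R) :
  ((p *: n + q *: b) *m n^T = p%:M) /\ ((p *: n + q *: b) *m b^T = q%:M).
Proof.
have := (frame_dot 1 1, frame_dot 1 2%:R, frame_dot 2%:R 1, frame_dot 2%:R 2%:R).
rewrite /= => -[[[nn nb] bn] bb].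
rewrite !mulmxDl -!scalemxAl nn nb bn bb !scale_scalar_mx !mulr0 !mulr1.
by rewrite -!raddfD /= addr0 add0r.
Qed.

Lemma enorm_frame_nb (p q : R) :
  enorm (p *: n + q *: b) = Num.sqrt (p ^+ 2 + q ^+ 2).
Proof.
have [dotn dotb] := frame_dot_nb p q.
rewrite enormE linearD !linearZ /= mulmxDr -!scalemxAr dotn dotb.
by rewrite !mxE !mulr1n !expr2.
Qed.

Lemma frame_nb_eq0 (p q : R) : p *: n + q *: b = 0 -> p = 0 /\ q = 0.
Proof.
have [dotn dotb] := frame_dot_nb p q => pq0; move: dotn dotb.
by rewrite pq0 !mul0mx => /rowP/(_ 0) + /rowP/(_ 0); rewrite !mxE !mulr1n.
Qed.

End Frame.

(** * Differentiating along a curve *)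

(** Reduces calculus on vector-valued curves to their coordinates; the product
    rule for a scalar function times a curve follows from the scalar one. *)
Lemma is_derive_mx (R : realFieldType) (V : normedModType R) (m n : nat)
    (M : V -> 'M[R]_(m, n)) (dM : 'M[R]_(m, n)) (x v : V) :
  is_derive x v M dM <->
  forall i j, is_derive x v (fun y => M y i j) (dM i j).
Proof.
split=> [[Mx <-] i j|Mx].
  by split; [exact: (derivable_mxP _ _ _).1 | rewrite derive_mx// mxE].
have dMx : derivable M x v by apply/derivable_mxP => i j; case: (Mx i j).
by split=> //; rewrite derive_mx//; apply/matrixP => i j; rewrite mxE derive_val.
Qed.

Lemma is_derive_scale_mx (R : realFieldType) (V : normedModType R) (m n : nat)
    (f : V -> R) (M : V -> 'M[R]_(m, n)) (df : R) (dM : 'M[R]_(m, n))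
    (x v : V) :
  is_derive x v f df -> is_derive x v M dM ->
  is_derive x v (fun y => f y *: M y) (f x *: dM + df *: M x).
Proof.
move=> fx /is_derive_mx Mx; apply/is_derive_mx => i j.
rewrite !mxE (mulrC df).
under eq_fun do rewrite mxE.
exact: is_deriveM.
Qed.

(** * The unit normal along the base curve *)

Section GNR.
Context {R : realType} {I : set R} {alpha T N B : R -> 'rV[R]_3}.
Context {kappa tau a1 a2 : R -> R}.
Hypothesis I_open : open I.
Hypothesis alpha_frenet : frenet_on I alpha T N B kappa tau.
Hypothesis a12_unit : forall s, I s -> a1 s ^+ 2 + a2 s ^+ 2 = 1.

Let U s := unit_surface_normal (gnr_surface alpha N B a1 a2) s 0.

Lemma gnr_unit_normal (s : R) : I s -> U s = - a2 s *: N s + a1 s *: B s.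
Proof.
move=> Is; have frame := frenet_frame alpha_frenet Is.
have dFs : derive1 ((gnr_surface alpha N B a1 a2)^~ 0) s = T s.
  under eq_fun do rewrite /gnr_surface /ruled_surface scale0r addr0.
  have dalpha := frenet_alpha alpha_frenet Is.
  by rewrite derive1E derive_val.
have dFu : derive1 (gnr_surface alpha N B a1 a2 s) 0 =
    a1 s *: N s + a2 s *: B s.
  rewrite derive1E; apply: derive_val.
  apply: is_derive_eq.
    apply: is_deriveD; apply: is_derive_scale_mx.
  by rewrite /= scaler0 !add0r scale1r.
rewrite /U /unit_surface_normal dFs dFu crossmulDr !crossmulZr.
rewrite (crossmul_frame_tn frame) (crossmul_frame_tb frame).
rewrite scalerN -scaleNr addrC (enorm_frame_nb frame) sqrrN addrC.
by rewrite (addrC (a2 s ^+ 2)) a12_unit// sqrtr1 invr1 scale1r addrC.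
Qed.

(** The formula for U holds on I only, but I is open, so near each of its points
    it may be differentiated. *)
Lemma gnr_is_derive_unit_normal (s : R) :
  I s -> derivable a1 s 1 -> derivable a2 s 1 ->
  is_derive s 1 U (kappa s * a2 s *: T s
    - (derive1 a2 s + a1 s * tau s) *: N s
    + (derive1 a1 s - a2 s * tau s) *: B s).
Proof.
move=> Is a1s a2s.
apply: (@near_eq_is_derive _ _ _ (fun x => (- a2 x) *: N x + a1 x *: B x)).
  have : \forall x \near s, I x by exact: open_nbhs_nbhs.
  by apply: filterS => x Ix; rewrite gnr_unit_normal.
have dN := frenet_N alpha_frenet Is.
have dB := frenet_B alpha_frenet Is.
have da1 := derivableP a1s; have da2 := derivableP a2s.
apply: is_derive_eq.
  apply: is_deriveD; apply: is_derive_scale_mx.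
rewrite -!derive1E; apply/rowP => k; rewrite !mxE; ring.
Qed.

Lemma gnr_crossmul_tangent (s : R) :
  I s -> derivable a1 s 1 -> derivable a2 s 1 ->
  crossmul (derive1 alpha s) (derive1 U s) =
  (- (derive1 a1 s - a2 s * tau s)) *: N s
  + (- (derive1 a2 s + a1 s * tau s)) *: B s.
Proof.
move=> Is a1s a2s; have frame := frenet_frame alpha_frenet Is.
have dalpha := frenet_alpha alpha_frenet Is.
have dU := gnr_is_derive_unit_normal s Is a1s a2s.
rewrite ![in LHS]derive1E !derive_val !crossmulDr -scaleNr !crossmulZr.
rewrite crossmulvv (crossmul_frame_tn frame) (crossmul_frame_tb frame).
by rewrite scaler0 add0r scalerN addrC -scaleNr.
Qed.

End GNR.

Theorem proposition3p9 (R : realType) (I : set R)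
    (alpha T N B : R -> 'rV[R]_3) (kappa tau a1 a2 : R -> R)
    (I_open : open I) (I_itv : is_interval I)
    (alpha_smooth : smooth_on I alpha)
    (alpha_unit_speed : unit_speed_on I alpha)
    (alpha_frenet : frenet_on I alpha T N B kappa tau)
    (a1_smooth : smooth_on I a1) (a2_smooth : smooth_on I a2)
    (a12_unit : forall s, I s -> a1 s ^+ 2 + a2 s ^+ 2 = 1) :
  base_curve_line_of_curvature I alpha (gnr_surface alpha N B a1 a2) <->
  (forall s, I s ->
     derive1 a2 s + a1 s * tau s = 0 /\ derive1 a1 s - a2 s * tau s = 0).
Proof.
have cross s (Is : I s) := gnr_crossmul_tangent I_open alpha_frenet a12_unit s
  Is (a1_smooth 0%N s Is) (a2_smooth 0%N s Is).
rewrite /base_curve_line_of_curvature /=.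
split=> [curv s Is|sys s Is]; last first.
  by have [e2 e1] := sys s Is; rewrite cross// e1 e2 !oppr0 !scale0r addr0.
have := curv s Is; rewrite cross//.
move=> /(frame_nb_eq0 (frenet_frame alpha_frenet Is))[/eqP + /eqP].
by rewrite !oppr_eq0 => /eqP ? /eqP.
Qed.
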